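(* Let $\mathcal{M}=(V,E,F)$ be a $G$-vertex-reversing map with $|V|,|F|\geq 3$, where $G$ is a solvable group all of whose Sylow subgroups are cyclic or dihedral. Then one of the following holds: (1) $G$ is a dihedral group; (2) $G\cong(\mathbb{Z}_m\times \mathrm{D}_{2^e}){:}\mathbb{Z}_2\cong \mathrm{D}_{2^e}{:}\mathrm{D}_{2m}$, where $m$ is odd and $e\geq 2$; (3) $G\cong \mathbb{Z}_{mn\ell}{:}\mathrm{D}_{2^e}\cong \mathbb{Z}_{2^{e-2}m}.(\mathrm{D}_{2n}\times \mathrm{D}_{2\ell})$, where $m,n,\ell$ are pairwise coprime odd integers and $e\geq 2$; (4) $G\cong(\mathrm{D}_4\times \mathbb{Z}_n){:}\mathrm{D}_{2\cdot 3^{f+1}}\cong \mathbb{Z}_{3^f n}.\mathrm{S}_4$, where $\gcd(n,6)=1$ and $f\geq 0$.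
   Context: All groups and maps are finite. A map $\mathcal{M}=(V,E,F)$ is a 2-cell embedding of a connected graph (multiple edges allowed, no loops or semi-edges) in a closed surface, with vertex, edge and face sets $V,E,F$. An arc is an incident (vertex, edge) pair. An automorphism is a permutation of the flags (mutually incident triples of vertex, edge, face) preserving incidence. For $G\leq \mathrm{Aut}(\mathcal{M})$, $\mathcal{M}$ is $G$-vertex-reversing if $G$ acts regularly on the arcs and, for a vertex $\alpha$, $G_\alpha$ is dihedral and acts regularly on the set of edges incident with $\alpha$. It is known that for every $G$-vertex-reversing map with $|V|,|F|\geq3$ the group $G$ has an arc-regular triple, i.e. involutions $x,y,z$ with $G=\langle x,y,z\rangle$ and $|G:\langle x,y\rangle|\geq 3$ (with vertex stabilizer $\langle x,y\rangle$ and edge stabilizer $\langle z\rangle$). $\mathrm{D}_{2n}$ is the dihedral group of order $2n$, with $\mathrm{D}_4\cong\mathbb{Z}_2^2$ regarded as dihedral. $A{:}B$ denotes a semidirect product with normal subgroup $A$; $A.B$ denotes an extension with normal subgroup $A$ and quotient $B$. *)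

(* Defs.v *)
From mathcomp Require Import all_boot all_fingroup all_solvable.

Set Implicit Arguments.
Unset Strict Implicit.
Unset Printing Implicit Defensive.

Local Open Scope group_scope.

(* A 2-cell embedding of a connected loopless graph (with at least one edge)  *)
(* in a closed surface, encoded by its flags, i.e., the triangles of the      *)
(* barycentric subdivision. Each flag f lies on one vertex, one edge and one  *)
(* face; [mt0 f], [mt1 f], [mt2 f] are the flags glued to f along the sides   *)
(* opposite to its vertex, edge and face corners: they change only the        *)
(* vertex, only the edge, only the face of f, respectively.                   *)
(* Vertices, edges and faces are thus the orbits of <mt1, mt2>, <mt0, mt2>    *)
(* and <mt0, mt1>. The mt_i have no fixed points as the surface is closed;    *)
(* a fixed point of mt0 mt2 would give a semi-edge.                           *)
Record surface_map := SurfaceMap {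
  mflag :> finType;
  mt0 : {perm mflag};
  mt1 : {perm mflag};
  mt2 : {perm mflag};
  mt0K : forall f, mt0 (mt0 f) = f;
  mt1K : forall f, mt1 (mt1 f) = f;
  mt2K : forall f, mt2 (mt2 f) = f;
  mt0_nfix : forall f, mt0 f != f;
  mt1_nfix : forall f, mt1 f != f;
  mt2_nfix : forall f, mt2 f != f;
  mt02C : forall f, mt0 (mt2 f) = mt2 (mt0 f);
  mt02_nfix : forall f, mt0 (mt2 f) != f;
  m_connected : [transitive <<[set mt0; mt1; mt2]>>, on [set: mflag] | 'P];
  m_loopless : forall f, mt0 f \notin orbit 'P <<[set mt1; mt2]>> f
}.

Section MapNotions.

Variable M : surface_map.

Definition vertices : {set {set M}} :=
  [set orbit 'P <<[set mt1 M; mt2 M]>> f | f : M].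
Definition edges : {set {set M}} :=
  [set orbit 'P <<[set mt0 M; mt2 M]>> f | f : M].
Definition faces : {set {set M}} :=
  [set orbit 'P <<[set mt0 M; mt1 M]>> f | f : M].

(* Two cells of different kinds are incident iff they share a flag. *)
Definition incident (A B : {set M}) : bool := A :&: B != set0.

Definition arcs : {set {set M} * {set M}} :=
  [set a | [&& a.1 \in vertices, a.2 \in edges & incident a.1 a.2]].

Definition edges_at (v : {set M}) : {set {set M}} :=
  [set e in edges | incident v e].

(* Flag permutations preserving the three adjacencies "same edge and face",   *)
(* "same vertex and face", "same vertex and edge" of flags.                   *)
Definition map_aut : {set {perm M}} :=
  [set g : {perm M} | [forall f, [&& g (mt0 M f) == mt0 M (g f),
                                     g (mt1 M f) == mt1 M (g f)
                                   & g (mt2 M f) == mt2 M (g f)]]].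

Definition pair_act (a : {set M} * {set M}) (g : {perm M}) :=
  ('P^*%act a.1 g, 'P^*%act a.2 g).

Lemma pair_act1 : pair_act^~ 1 =1 id.
Proof. by case=> v e; rewrite /pair_act !act1. Qed.

Lemma pair_actM (a : {set M} * {set M}) : act_morph pair_act a.
Proof. by case: a => v e g h; rewrite /pair_act !actM. Qed.

Definition pair_action := TotalAction pair_act1 pair_actM.

End MapNotions.

Definition regular_on (aT : finGroupType) (D : {set aT}) (rT : finType)
    (to : action D rT) (A : {set aT}) (S : {set rT}) : Prop :=
  [transitive A, on S | to] /\ {in S, forall s, 'C_A[s | to] = 1}.

(* A is a dihedral group D_{2n} of order 2n, for n > 0, with D_2 = Z_2: this  *)
(* case is separate because the library's 'D_m is only meaningful for m >= 4. *)
Definition is_D2 (n : nat) (gT : finGroupType) (A : {set gT}) : bool :=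
  if n == 1%N then #|A| == 2%N else A \isog 'D_(n.*2).

(* D_4 is dihedral, Z_2 is not. *)
Definition dihedral (gT : finGroupType) (A : {set gT}) : Prop :=
  exists2 n, 1 < n & is_D2 n A.

Definition vertex_reversing (M : surface_map) (G : {group {perm M}}) : Prop :=
  [/\ G \subset map_aut M,
      regular_on (pair_action M) G (arcs M)
    & forall v, v \in vertices M ->
        dihedral 'C_G[v | 'P^*] /\
        regular_on 'P^* 'C_G[v | 'P^*] (edges_at v)].

(* Main.v *)
Require Import Defs.
From mathcomp Require Import all_boot all_fingroup all_solvable.

(** The automorphism group [G] of a vertex-reversing map is generated by
involutions: a vertex stabilizer is dihedral, the two arcs on an edge are
swapped by an involution, and by connectedness these elements generate [G].
Together with the condition on Sylow subgroups this determines [G].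

The commutator quotient of a group generated by involutions has exponent 2, so
every element of odd order lies in [G^`(1)], and hence centralizes every
cyclic normal subgroup, whose automorphism group is abelian
([odd_cent_cyclic]). Let [O] be the largest normal subgroup of odd order and
[W] the largest normal 2-subgroup. As the Fitting subgroup contains its own
centralizer and its odd part is cyclic, [O] is cyclic, and an element of odd
order that centralizes [W] already lies in [O] ([odd_core_cyclic]). So
everything depends on how elements of odd order act on [W], a subgroup of a
Sylow 2-subgroup [T].

If [T] is cyclic, so is [W], the action is trivial, and [O] complements [T];
generation by involutions then forces [T] to have order 2 and to invert [O]:
[G] is dihedral ([cyclic_Sylow2_dihedral]).

If [T] is dihedral, its rotations meet [W] in a cyclic subgroup of index at
most 2. When that subgroup has order at least 4 it is generated by an element
that is no involution, while all of [W] outside it consists of involutions; so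
it is normal in [G] and the action on [W] is trivial again. Hence either [O]
complements [T], or [W] is a Klein group that contains its centralizer in [T]
([dihedral_Sylow2_dichotomy]).

If [O] complements [T], two reflections generating [T] split the cyclic group
[O] into four parts according to whether they centralize or invert. The part
centralized by both is trivial, again because [G] is generated by involutions;
the other three parts have the pairwise coprime orders [m], [n], [l] of the
third alternative ([dihedral_Sylow2_split]). In particular the groups of the
second alternative, whose Sylow 2-subgroups also complement a cyclic group of
odd order, appear among those of the third.

If [W] is a Klein group, the quotient of [G] by the centralizer [O * W] of [W]
embeds into the symmetric group on the three involutions of [W]. It is
generated by involutions, so its order is not 3; if it is at most 2, then [O]
complements [T] once more, and if it is 6, then [G] acts on four points with
kernel [O] and image [S_4] ([klein_core_dichotomy] and
[klein_core_structure]). *)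

Set Implicit Arguments.
Unset Strict Implicit.
Unset Printing Implicit Defensive.

Local Open Scope group_scope.

Implicit Types gT rT : finGroupType.

(** * Dihedral groups *)

Lemma is_D2_card gT (A : {group gT}) n : 0 < n -> is_D2 n A -> #|A| = n.*2.
Proof.
rewrite /is_D2; case: eqP => [-> _ /eqP // | /eqP n1 n_gt0 /card_isog ->].
by rewrite card_dihedral // ltn_neqAle eq_sym n1.
Qed.

(** Two distinct involutions generate a dihedral group; the order hypothesis
takes care of the degenerate pairs, since a trivial or repeated generator
leaves at most two elements. *)
Lemma is_D2_gen gT (x y : gT) n :
    0 < n -> x ^+ 2 = 1 -> y ^+ 2 = 1 -> #|<<[set x; y]>>| = n.*2 ->
  is_D2 n <<[set x; y]>>.
Proof.
move=> n_gt0 x2 y2 oG; rewrite /is_D2; case: eqP => [n1 | /eqP n1].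
  by rewrite oG n1.
have n_gt1: 1 < n by rewrite ltn_neqAle eq_sym n1.
have small z : z ^+ 2 = 1 -> ~~ (<<[set x; y]>> \subset <[z]>).
  move=> z2; apply/negP=> /subset_leq_card; rewrite oG leqNgt => /negP; apply.
  rewrite (@leq_ltn_trans 2) //; last by rewrite (ltn_double 1).
  by apply: dvdn_leq => //; rewrite -orderE order_dvdn z2.
have ord2 z : z ^+ 2 = 1 -> z != 1 -> #[z] = 2.
  by move=> z2 nz1; apply: nt_prime_order.
have x1: x != 1.
  apply: contraNneq (small y y2) => ->.
  by rewrite gen_subG subUset !sub1set cycle_id group1.
have y1: y != 1.
  apply: contraNneq (small x x2) => ->.
  by rewrite gen_subG subUset !sub1set cycle_id group1.
rewrite -oG; apply: involutions_gen_dihedral; rewrite ?ord2 //.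
apply: contraNneq (small x x2) => <-.
by rewrite gen_subG subUset !sub1set cycle_id.
Qed.

(** A rotation and a reflection read off from the presentation of the
dihedral group. The relations alone only bound the orders of the two
generators from above; counting makes the order of the rotation exact. *)
Lemma is_D2_presentation gT (A : {group gT}) n :
    1 < n -> is_D2 n A ->
  exists x y, [/\ <[x]> <*> <[y]> = A, #[x] = n, y ^+ 2 = 1 & x ^ y = x^-1].
Proof.
move=> n_gt1; rewrite /is_D2 (gtn_eqF n_gt1) => isoA.
have oA : #|A| = n.*2 by rewrite (card_isog isoA) card_dihedral.
have: A \homg 'D_(n.*2) by rewrite isog_hom.
rewrite (Grp_dihedral n_gt1) /=.
case/existsP=> [[x y]] /= /eqP[defA xn y2 xy].
exists x, y; split=> //; apply/eqP; rewrite eqn_leq.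
have x_le: #[x] <= n by apply: dvdn_leq; rewrite ?order_dvdn ?xn // ltnW.
have y_le: #[y] <= 2 by apply: dvdn_leq; rewrite ?order_dvdn ?y2.
rewrite x_le /= -(leq_pmul2r (m := 2)) // muln2 -oA -defA.
rewrite norm_joinEr; last first.
  by rewrite cycle_subG; apply/normP; rewrite -cycleJ xy cycleV.
rewrite (leq_trans (dvdn_leq _ (dvdn_cardMg _ _))) ?muln_gt0 ?order_gt0 //.
exact: leq_mul.
Qed.

Lemma gen_mulg_pair gT (k v : gT) : <<[set v; v * k]>> = <[k]> <*> <[v]>.
Proof.
apply/eqP; rewrite eqEsubset gen_subG subUset !sub1set join_subG !cycle_subG.
have Kk : k \in <[k]> <*> <[v]> by rewrite mem_gen // inE cycle_id.
have Kv : v \in <[k]> <*> <[v]> by rewrite mem_gen // inE cycle_id orbT.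
have Hv : v \in <<[set v; v * k]>> by rewrite mem_gen // !inE eqxx.
by rewrite Kv groupM //= Hv -(groupMl k Hv) mem_gen // !inE eqxx orbT.
Qed.

Lemma sqr_mulg_inverted gT (t k : gT) :
  t ^+ 2 = 1 -> k ^ t = k^-1 -> (t * k) ^+ 2 = 1.
Proof.
move=> t2 kt.
by rewrite expgS expg1 -mulgA [k * _]mulgA (conjgC k t) kt mulgKV -expg2.
Qed.

(** The three ways in which elements outside the rotation subgroup are used:
they are involutions, they invert every rotation, and any two of them differ
by a rotation. The group may be Klein, so that rotations can be involutions
too. *)
Lemma dihedral_off_rotations gT (T : {group gT}) a y :
    <[a]> <*> <[y]> = T -> y ^+ 2 = 1 -> a ^ y = a^-1 ->
  forall t, t \in T -> t \notin <[a]> ->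
    [/\ t ^+ 2 = 1, forall c, c \in <[a]> -> c ^ t = c^-1 &
        forall s, s \in T -> s \notin <[a]> -> s * t^-1 \in <[a]>].
Proof.
move=> defT y2 ay.
have nay: <[y]> \subset 'N(<[a]>).
  by rewrite cycle_subG; apply/normP; rewrite -cycleJ ay cycleV.
have form t : t \in T -> t \notin <[a]> -> exists2 b, b \in <[a]> & t = b * y.
  rewrite -defT norm_joinEr // => /mulsgP[b z Ab /cycleP[j ->] ->] nAt.
  exists b => //; move: nAt.
  rewrite -[j]odd_double_half -mul2n expgD expgM y2 expg1n mulg1.
  by case: (odd j); rewrite ?expg1 // expg0 mulg1 Ab.
have inv b : b \in <[a]> -> b ^ y = b^-1.
  by case/cycleP=> i ->; rewrite conjXg ay expgVn.
have yV : y^-1 = y by apply/eqP; rewrite eq_invg_mul -y2.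
move=> t Tt nAt; have [b Ab ->] := form t Tt nAt; split.
- rewrite expgS expg1 -mulgA (mulgA y) (conjgCV y b) yV inv //.
  by rewrite -mulgA mulKVg -[RHS]y2.
- move=> c Ac; rewrite conjgM -inv //; congr (_ ^ _).
  by apply/conjg_fixP/commgP; apply: (centsP (cycle_abelian a)).
move=> s Ts nAs; have [d Ad ->] := form s Ts nAs.
by rewrite invMg mulgA mulgK groupM ?groupV.
Qed.

(** * Groups generated by involutions *)

(** The identity is admitted among the generators, which makes the notion
stable under morphisms that kill some of the involutions. *)
Definition involution_generated (gT : finGroupType) (G : {set gT}) : bool :=
  G \subset <<[set t in G | t ^+ 2 == 1]>>.

Lemma involution_generated_sub gT (G H : {group gT}) :
    involution_generated G -> (forall t, t \in G -> t ^+ 2 = 1 -> t \in H) ->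
  G \subset H.
Proof.
move=> igG sH; apply: subset_trans igG _; rewrite gen_subG.
by apply/subsetP=> t; rewrite inE => /andP[Gt /eqP t2]; apply: sH.
Qed.

Lemma morphim_involution_generated gT rT (D G : {group gT})
    (f : {morphism D >-> rT}) :
  G \subset D -> involution_generated G -> involution_generated (f @* G).
Proof.
move=> sGD igG; rewrite /involution_generated.
rewrite sub_morphim_pre //; apply: (involution_generated_sub igG) => t Gt t2.
have Dt := subsetP sGD t Gt; rewrite mem_morphpre // mem_gen // inE.
by rewrite mem_morphim //= -morphX // t2 morph1.
Qed.

Lemma quotient_involution_generated gT (G H : {group gT}) :
  G \subset 'N(H) -> involution_generated G -> involution_generated (G / H).
Proof. exact: morphim_involution_generated. Qed.

Lemma isog_involution_generated gT rT (G : {group gT}) (H : {group rT}) :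
  G \isog H -> involution_generated G -> involution_generated H.
Proof. by case/isogP=> f _ <-; apply: morphim_involution_generated. Qed.

Lemma dihedral_involution_generated gT (A : {group gT}) :
  dihedral A -> involution_generated A.
Proof.
case=> n n_gt1 dihA.
have [x [y [defA _ y2 xy]]] := is_D2_presentation n_gt1 dihA.
have Ax : x \in A by rewrite -defA mem_gen // inE cycle_id.
have Ay : y \in A by rewrite -defA mem_gen // inE cycle_id orbT.
have Hy : y \in <<[set t in A | t ^+ 2 == 1]>>.
  by rewrite mem_gen // inE Ay y2 /=.
rewrite /involution_generated -{1}defA join_subG !cycle_subG Hy andbT.
rewrite -(groupMl x Hy) mem_gen // inE groupM //=.
by rewrite sqr_mulg_inverted.
Qed.

Lemma involution_generated_odd gT (G : {group gT}) :
  involution_generated G -> odd #|G| -> G :=: 1.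
Proof.
move=> igG oddG; apply/trivgP; apply: (involution_generated_sub igG) => t Gt t2.
rewrite inE -order_eq1.
have : #[t] %| 2 by rewrite order_dvdn t2.
rewrite dvdn_divisors // !inE => /orP[// | /eqP t_2].
by have := order_dvdG Gt; rewrite t_2 dvdn2 oddG.
Qed.

(** The elements whose square lies in the commutator subgroup form a group,
because the quotient by the commutator subgroup is abelian, and this group
contains all involutions. *)
Lemma sqr_in_der1 gT (G : {group gT}) x :
  involution_generated G -> x \in G -> x ^+ 2 \in G^`(1).
Proof.
move=> igG Gx; have nG' := der_norm 1 G; have abG := der_abelian 0 G.
pose K := [set y in G | y ^+ 2 \in G^`(1)].
have gK: group_set K.
  apply/group_setP; split=> [|y z]; first by rewrite inE !group1 expg1n group1.
  rewrite !inE => /andP[Gy y2] /andP[Gz z2]; rewrite groupM //=.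
  have [Ny Nz] := (subsetP nG' y Gy, subsetP nG' z Gz).
  apply: coset_idr; first by rewrite groupX ?groupM.
  rewrite morphX ?groupM ?morphM //= expgMn; last first.
    by apply: (centsP abG); apply: mem_quotient.
  by rewrite -!morphX //= !coset_id // mulg1.
have /subsetP/(_ x Gx): G \subset Group gK; last by rewrite inE => /andP[].
apply: (involution_generated_sub igG) => t Gt t2.
by rewrite inE Gt t2 group1.
Qed.

(** An element of odd order is a power of its own square. *)
Lemma odd_in_der1 gT (G : {group gT}) x :
  involution_generated G -> x \in G -> odd #[x] -> x \in G^`(1).
Proof.
move=> igG Gx odx; have co2: coprime #[x] 2 by rewrite coprime_sym coprime2n.
by rewrite -[x](expgK co2 (cycle_id x)) groupX // sqr_in_der1.
Qed.

(** The action on [D] goes through the abelian group [Aut D], so commutators act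
trivially. *)
Lemma der1_cent_cyclic gT (G D : {group gT}) :
  cyclic D -> G \subset 'N(D) -> G^`(1) \subset 'C(D).
Proof.
move=> cycD nDG; rewrite -ker_conj_aut -sub_morphim_pre ?gFsub_trans //.
rewrite morphim_der //; apply/trivgP/derG1P/(abelianS (Aut_conj_aut _ _)).
exact: Aut_cyclic_abelian.
Qed.

(** The main consequence of generation by involutions: elements of odd order
cannot act nontrivially on a cyclic normal subgroup. *)
Lemma odd_cent_cyclic gT (G D : {group gT}) x :
    involution_generated G -> cyclic D -> G \subset 'N(D) ->
  x \in G -> odd #[x] -> x \in 'C(D).
Proof.
move=> igG cycD nDG Gx odx; apply: (subsetP (der1_cent_cyclic cycD nDG)).
exact: odd_in_der1.
Qed.

(** Write [C] for the centralizer of the Fitting subgroup. Its own Fitting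
subgroup lies in that of [G], so it is central in [C]; a nilpotent normal
subgroup of the quotient of [C] by it therefore lifts to a nilpotent normal
subgroup of [C], so this quotient has trivial Fitting subgroup, and being
solvable it is trivial. *)
Lemma cent_sub_Fitting gT (G : {group gT}) :
  solvable G -> 'C_G('F(G)) \subset 'F(G).
Proof.
move=> solG; pose C := 'C_G('F(G))%G; change (C \subset 'F(G)).
have nsCG: C <| G by rewrite norm_normalI ?norms_cent // gFnorm.
have solC : solvable C := solvableS (normal_sub nsCG) solG.
have sFC_FG: 'F(C) \subset 'F(G).
  by rewrite Fitting_max ?Fitting_nil // gFnormal_trans.
have sFC_Z (K : {group gT}) :
    K \subset C -> 'F(C) \subset K -> 'F(C) \subset 'Z(K).
  move=> sKC sFK; rewrite subsetI sFK centsC (subset_trans sKC) //.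
  by rewrite (subset_trans (subsetIr _ _)) // centS.
have [nFC sFC] := (normal_norm (Fitting_normal C), Fitting_sub C).
suff trivF: 'F(C / 'F(C)) == 1.
  rewrite trivg_Fitting ?quotient_sol // in trivF.
  by rewrite (subset_trans _ sFC_FG) // -quotient_sub1 // (eqP trivF).
have [K defK sFK nsKC] :=
  inv_quotientN (Fitting_normal C) (Fitting_normal (C / 'F(C))).
have sKC := normal_sub nsKC; have sFZ := sFC_Z K sKC sFK.
have nsFK: 'F(C) <| K by rewrite /normal sFK (subset_trans sKC).
rewrite defK -subG1 (quotient_sub1 (normal_norm nsFK)).
apply: (Fitting_max nsKC); rewrite -(quotient_center_nil K).
have isoK := third_isog sFZ nsFK (center_normal K).
rewrite -(isog_nil isoK) quotient_nil //.
by have := Fitting_nil (C / 'F(C)); rewrite defK.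
Qed.

(** * Involutions acting on cyclic groups of odd order *)

Definition inverted (gT : finGroupType) (O : {set gT}) (t : gT) : {set gT} :=
  [set x in O | x ^ t == x^-1].

(** The decomposition of an abelian group of odd order into the eigenspaces
of an involution for the values 1 and -1. The square of [x] is the product of
[x * x ^ t] and [x * (x ^ t)^-1], one in each part, and squaring is bijective
in odd order. *)
Lemma cent_inverted_dprod gT (O : {group gT}) t :
    abelian O -> odd #|O| -> t \in 'N(O) -> t ^+ 2 = 1 ->
  'C_O[t] \x inverted O t = O.
Proof.
move=> abO oddO nOt t2; have cO := centsP abO.
have gI: group_set (inverted O t).
  apply/group_setP; split=> [|x y].
    by rewrite inE group1 conj1g invg1 eqxx.
  rewrite !inE => /andP[Ox /eqP xt] /andP[Oy /eqP yt].
  by rewrite groupM //= conjMg xt yt -invMg cO.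
pose I := Group gI; change ('C_O[t] \x I = O).
have sIO: I \subset O by apply/subsetP=> x; rewrite inE => /andP[].
have sCO: 'C_O[t] \subset O by apply: subsetIl.
have cCI: I \subset 'C('C_O[t]).
  by rewrite (subset_trans sIO) // (subset_trans abO) // centS.
have odd1 x : x \in O -> x ^+ 2 = 1 -> x = 1.
  move=> Ox x2; apply/eqP; rewrite -order_eq1 -dvdn1.
  have co2: coprime #[x] 2.
    by rewrite coprime_sym coprime2n (dvdn_odd (order_dvdG Ox)).
  by rewrite -(Gauss_dvdl _ co2) mul1n order_dvdn x2.
rewrite dprodE //; last first.
  apply/trivgP/subsetP=> x /setIP[/setIP[Ox /cent1P ctx]].
  rewrite !inE (elimT conjg_fixP (introT commgP ctx)) => /andP[_ /eqP xV].
  by rewrite (odd1 x) // expgS expg1 {1}xV mulVg.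
have sqrK x : x \in O -> x ^+ 2 \in 'C_O[t] * I.
  move=> Ox; have Oxt: x ^ t \in O by rewrite memJ_norm.
  have xtt: (x ^ t) ^ t = x by rewrite -conjgM -[t * t]/(t ^+ 2) t2 conjg1.
  have -> : x ^+ 2 = (x * x ^ t) * (x * (x ^ t)^-1).
    by rewrite [x * (x ^ t)^-1]cO ?groupV // mulgA mulgK.
  apply: mem_mulg.
    apply/setIP; split; first by rewrite groupM.
    by apply/cent1P/commgP/conjg_fixP; rewrite conjMg xtt cO.
  rewrite inE groupM ?groupV //=.
  by rewrite conjMg conjVg xtt invMg invgK.
apply/eqP; rewrite eqEsubset mul_subG //=; apply/subsetP=> x Ox.
have co2: coprime #[x] 2.
  by rewrite coprime_sym coprime2n (dvdn_odd (order_dvdG Ox)).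
rewrite -(expgK co2 (cycle_id x)) -(cent_joinEr cCI) groupX //.
by rewrite /= (cent_joinEr cCI) sqrK.
Qed.

(** Every involution of [G] is conjugate under [O] to one in [S], so it lies in
[[~: O, S] <*> S]; this subgroup is then all of [G], and comparing orders
leaves no room for [S] to be smaller than [T] or the commutator subgroup
smaller than [O]. *)
Lemma involution_generated_sdprod gT (G O T S : {group gT}) :
    involution_generated G -> 2.-Sylow(G) T -> O ><| T = G ->
    S \subset T -> (forall t, t \in T -> t ^+ 2 = 1 -> t \in S) ->
  S :=: T /\ [~: O, S] = O.
Proof.
move=> igG sylT defG sST invS.
have [_ _ defOT nOT _] := sdprod_context defG.
have nOS := subset_trans sST nOT.
have sRO: [~: O, S] \subset O by rewrite commg_subl.
pose H := ([~: O, S] <*> S)%G.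
have sGH: G \subset H.
  apply: (involution_generated_sub igG) => t Gt t2.
  have p_t: 2.-group <[t]>.
    by rewrite /pgroup -orderE (pnat_dvd (n := 2)) ?pnat_id // order_dvdn t2.
  have sTG' : <[t]> \subset G by rewrite cycle_subG.
  have [x Gx] := Sylow_Jsub sylT sTG' p_t.
  rewrite -cycleJ cycle_subG; move: Gx; rewrite -defOT => /mulsgP[o s Oo Ts ->].
  rewrite conjgM.
  have -> : ((t ^ o) ^ s \in T) = (t ^ o \in T).
    by rewrite memJ_norm // (subsetP (normG T)).
  move=> Tto; have Sto: t ^ o \in S by rewrite invS // -conjXg t2 conj1g.
  have -> : t = t ^ o * [~ t ^ o, o^-1] by rewrite -conjg_mulR conjgK.
  rewrite groupM //; first by rewrite mem_gen // inE Sto orbT.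
  by rewrite mem_gen // inE commGC mem_commg ?groupV.
have nRS: S \subset 'N([~: O, S]).
  by rewrite (subset_trans _ (commg_norm O S)) // joing_subr.
have leG: #|O| * #|T| <= #|[~: O, S]| * #|S|.
  rewrite (sdprod_card defG) (leq_trans (subset_leq_card sGH)) //=.
  by rewrite norm_joinEr // dvdn_leq ?muln_gt0 ?cardG_gt0 // dvdn_cardMg.
have [leS leR] := (subset_leq_card sST, subset_leq_card sRO).
split; apply/eqP; rewrite eqEcard ?sST ?sRO /=.
  rewrite -(leq_pmul2l (cardG_gt0 O)) (leq_trans leG) // leq_mul2r leR orbT //.
rewrite -(leq_pmul2r (cardG_gt0 T)) (leq_trans leG) // leq_mul2l leS orbT //.
Qed.

(** An involution outside [O] fixes no nontrivial element of
[[~: O, T] = O], so the eigenspace decomposition shows that it inverts [O]. *)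
Lemma odd_normal_cyclic_index2_dihedral gT (G O : {group gT}) :
    involution_generated G -> O <| G -> cyclic O -> odd #|O| ->
    #|G| = (#|O| * 2)%N ->
  is_D2 #|O| G.
Proof.
move=> igG nsOG cycO oddO oG.
have [T sylT] := Sylow_exists 2 G.
have hallO: 2^'.-Hall(G) O.
  rewrite pHallE normal_sub //= oG partnM ?cardG_gt0 //.
  rewrite part_pnat_id -?odd_2'nat //.
  by rewrite (part_p'nat (pi := 2^') (n := 2)) ?muln1.
have defG: O ><| T = G by apply/(sdprod_normal_pHallP nsOG sylT).
have oT: #|T| = 2.
  by apply/eqP; rewrite -(eqn_pmul2l (cardG_gt0 O)) (sdprod_card defG) oG.
have [t defT ot] : exists2 t, T :=: <[t]> & #[t] = 2.
  have /cyclicP[t defT] : cyclic T by rewrite prime_cyclic ?oT.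
  by exists t => //; rewrite orderE -defT.
have [nsO sTG mulOT nOT tiOT] := sdprod_context defG.
have t2: t ^+ 2 = 1 by rewrite -ot expg_order.
have nOt: t \in 'N(O) by rewrite (subsetP nOT) // defT cycle_id.
have abO := cyclic_abelian cycO.
have [_ defO] :=
  involution_generated_sdprod igG sylT defG (subxx T) (fun t Tt _ => Tt).
have tiC: 'C_O[t] = 1.
  rewrite -cent_cycle -defT -{1}defO coprime_abel_cent_TI //.
  by rewrite oT coprime_sym coprime2n.
have := cent_inverted_dprod abO oddO nOt t2; rewrite tiC dprod1g => defI.
have [k defk] := cyclicP cycO.
have kt: k ^ t = k^-1.
  by apply/eqP; move: (cycle_id k); rewrite -defk -defI inE => /andP[].
have defG2 : G :=: <<[set t; t * k]>>.
  by rewrite gen_mulg_pair -defk -defT norm_joinEr.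
rewrite defG2; apply: is_D2_gen; rewrite ?cardG_gt0 // -?defG2 ?oG ?muln2 //.
exact: sqr_mulg_inverted.
Qed.

(** * The odd core *)

Lemma odd_elements_Hall gT (G : {group gT}) :
    solvable G -> (forall x, x \in G -> odd #[x] -> x \in 'O_2^'(G)) ->
  2^'.-Hall(G) 'O_2^'(G).
Proof.
move=> solG sO; have [K hallK] := Hall_exists 2^' solG.
suff <- : K :=: 'O_2^'(G) by [].
apply/eqP; rewrite eqEsubset (pcore_sub_Hall hallK) andbT.
apply/subsetP=> x Kx; apply: sO; first exact: (subsetP (pHall_sub hallK)).
by rewrite odd_2'nat; apply: mem_p_elt (pHall_pgroup hallK) Kx.
Qed.

Lemma pcore_pcoreC_cent pi gT (G : {group gT}) :
  'O_pi^'(G) \subset 'C('O_pi(G)).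
Proof.
apply/commG1P/trivgP; rewrite -(coprime_TIg (coprime_pcoreC pi G G)) setIC.
apply: commg_subI; rewrite subsetI subxx.
  exact: subset_trans (pcore_sub _ _) (gFnorm _ _).
exact: subset_trans (pcore_sub _ _) (gFnorm _ _).
Qed.

(** The Fitting subgroup is the product of its 2-part, which is the 2-core of
[G], and its odd part [D], which is nilpotent with cyclic Sylow subgroups and
hence cyclic. An element of odd order centralizes [D]; if it also centralizes
the 2-core, it centralizes the Fitting subgroup, so it lies in it and
then in [D]. All elements of the odd core are of this kind. *)
Lemma odd_core_cyclic gT (G : {group gT}) :
    involution_generated G -> solvable G ->
    (forall (p : nat) (P : {group gT}),
       prime p -> odd p -> p.-Sylow(G) P -> cyclic P) ->
  cyclic 'O_2^'(G) /\
  (forall x, x \in G -> odd #[x] -> x \in 'C('O_2(G)) -> x \in 'O_2^'(G)).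
Proof.
move=> igG solG cycSyl; pose F := 'F(G)%G; pose D := 'O_2^'(F)%G.
have sFG : F \subset G by apply: Fitting_sub.
have sDG : D \subset G by apply: subset_trans (pcore_sub _ _) sFG.
have nDG : G \subset 'N(D) by rewrite normal_norm // !gFnormal_trans.
have pD : 2^'.-group D by apply: pcore_pgroup.
have cycD : cyclic D.
  apply: nil_Zgroup_cyclic; last first.
    exact: nilpotentS (pcore_sub _ _) (Fitting_nil G).
  apply/forall_inP=> V /SylowP[p p_pr sylV].
  have [p2 | op] := even_prime p_pr.
    have : #|V| = 1%N by rewrite (card_Hall sylV) p2 part_p'nat.
    by move/card1_trivg->; apply: cyclic1.
  have sVG : V \subset G := subset_trans (pHall_sub sylV) sDG.
  have [P sylP sVP] := Sylow_superset sVG (pHall_pgroup sylV).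
  exact: cyclicS sVP (cycSyl p P p_pr op sylP).
have key x : x \in G -> odd #[x] -> x \in 'C('O_2(G)) -> x \in D.
  move=> Gx ox cWx; have Fx: x \in F.
    apply: (subsetP (cent_sub_Fitting solG)); apply/setIP; split=> //.
    have defF: 'O_2(F) * D = F.
      by case/dprodP: (nilpotent_pcoreC 2 (Fitting_nil G)).
    rewrite -['F(G)]defF centM; apply/setIP; split.
      by rewrite -(p_core_Fitting 2 G) in cWx.
    exact: odd_cent_cyclic igG cycD nDG Gx ox.
  rewrite (mem_Hall_pcore (nilpotent_pcore_Hall _ (Fitting_nil G))) //.
  by rewrite /p_elt -odd_2'nat.
have sDO : D \subset 'O_2^'(G) by apply: pcore_Fitting.
split; last by move=> x Gx ox cWx; apply: (subsetP sDO); apply: key.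
apply: cyclicS cycD; apply/subsetP=> x Ox.
have Gx : x \in G := subsetP (pcore_sub _ _) x Ox.
apply: key => //.
  by rewrite odd_2'nat; apply: mem_p_elt (pcore_pgroup _ _) Ox.
exact: (subsetP (pcore_pcoreC_cent 2 G)).
Qed.

Lemma odd_core_sdprod gT (G T : {group gT}) :
  2.-Sylow(G) T -> 2^'.-Hall(G) 'O_2^'(G) -> 'O_2^'(G) ><| T = G.
Proof.
by move=> sylT hallO; apply/(sdprod_normal_pHallP (pcore_normal _ _) sylT).
Qed.

(** Here [involution_generated_sdprod] is used with [S] generated by the
involutions of [T], a group of order 2 because [T] is cyclic; it forces
[T = S]. *)
Lemma cyclic_Sylow2_dihedral gT (G T : {group gT}) :
    involution_generated G -> solvable G -> G :!=: 1 ->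
    (forall (p : nat) (P : {group gT}),
       prime p -> odd p -> p.-Sylow(G) P -> cyclic P) ->
    2.-Sylow(G) T -> cyclic T ->
  is_D2 #|'O_2^'(G)| G.
Proof.
move=> igG solG ntG cycSyl sylT cycT.
have [cycO key] := odd_core_cyclic igG solG cycSyl.
have hallO: 2^'.-Hall(G) 'O_2^'(G).
  apply: odd_elements_Hall => // x Gx ox; apply: key => //.
  have cycW: cyclic 'O_2(G) by apply: cyclicS cycT; apply: pcore_sub_Hall.
  exact: odd_cent_cyclic igG cycW (gFnorm _ _) Gx ox.
have defG := odd_core_sdprod sylT hallO.
have pT := pHall_pgroup sylT.
have ntT: T :!=: 1.
  apply: contra ntG => /eqP T1; apply/eqP.
  apply: involution_generated_odd => //.
  rewrite -(sdprod_card defG) T1 cards1 muln1 odd_2'nat.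
  exact: (pcore_pgroup 2^' G).
have [] := involution_generated_sdprod igG sylT defG (Ohm_sub 1 T).
  move=> t Tt t2; rewrite /= (OhmE 1 pT) mem_gen // !inE Tt /=.
  by rewrite expn1 t2.
move=> /esym defT _; apply: odd_normal_cyclic_index2_dihedral => //=.
- exact: pcore_normal.
- by rewrite odd_2'nat; apply: pcore_pgroup.
by rewrite -(sdprod_card defG) defT (Ohm1_cyclic_pgroup_prime cycT pT ntT).
Qed.

(** * Dihedral Sylow 2-subgroups *)

(** Let [R] be the group of rotations in the 2-core [W], generated by [b], and
[w] an element of [W] that is no rotation. If [b] is not of order at most 2,
then [R] is normal in [G] since every conjugate of [b] must again be a
rotation; an element [x] of odd order then centralizes [R] and multiplies [w]
by some [r] in [R], and iterating the action shows that the order of [r]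
divides the odd order of [x], so that [r = 1]. If [b] has order at most 2,
then [W] has order 2 or is the Klein group generated by [w] and [b]. *)
Lemma dihedral_Sylow2_dichotomy gT (G T : {group gT}) n :
    involution_generated G -> solvable G ->
    (forall (p : nat) (P : {group gT}),
       prime p -> odd p -> p.-Sylow(G) P -> cyclic P) ->
    2.-Sylow(G) T -> 1 < n -> is_D2 n T ->
  2^'.-Hall(G) 'O_2^'(G) \/
  [/\ #|'O_2(G)| = 4, is_D2 2 'O_2(G) & 'C_T('O_2(G)) \subset 'O_2(G)].
Proof.
move=> igG solG cycSyl sylT n_gt1 dihT.
have [cycO key] := odd_core_cyclic igG solG cycSyl.
set W := 'O_2(G) in key *.
have suffC : (forall x, x \in G -> odd #[x] -> x \in 'C(W)) ->
    2^'.-Hall(G) 'O_2^'(G).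
  move=> cW; apply: odd_elements_Hall => // x Gx ox.
  by apply: key => //; apply: cW.
have [a [y [defT oa y2 ay]]] := is_D2_presentation n_gt1 dihT.
have off := dihedral_off_rotations defT y2 ay.
have nsWG : W <| G := pcore_normal _ _.
have sWT : W \subset T := pcore_sub_Hall sylT.
have pW : 2.-group W := pcore_pgroup _ _.
have cycW_Hall : cyclic W -> 2^'.-Hall(G) 'O_2^'(G).
  move=> cycW; apply: suffC => x Gx ox.
  exact: odd_cent_cyclic igG cycW (normal_norm nsWG) Gx ox.
have [sWa | ] := boolP (W \subset <[a]>).
  by left; apply/cycW_Hall/(cyclicS sWa)/cycle_cyclic.
case/subsetPn=> w Ww nAw; have Tw := subsetP sWT w Ww.
have [w2 invw offw] := off w Tw nAw.
pose R := (W :&: <[a]>)%G.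
have cycR : cyclic R := cyclicS (subsetIr _ _) (cycle_cyclic a).
have sRW : R \subset W := subsetIl _ _.
have Wsplit x : x \in W -> x \notin <[a]> -> x * w^-1 \in R.
  by move=> Wx nAx; rewrite inE groupM ?groupV // offw // (subsetP sWT).
have [b defR] := cyclicP cycR.
have Rb : b \in R by rewrite defR cycle_id.
have [Wb Ab] := setIP Rb.
have [b2 | b2] := eqVneq (b ^+ 2) 1; last first.
  left; apply: suffC => x Gx ox.
  have nRG : G \subset 'N(R).
    apply/subsetP=> g Gg; rewrite inE defR -cycleJ cycle_subG /= -defR inE.
    have Wbg : b ^ g \in W by rewrite memJ_norm // (subsetP (normal_norm nsWG)).
    rewrite Wbg /=; apply: contraR b2 => nAbg.
    have [bg2 _ _] := off _ (subsetP sWT _ Wbg) nAbg.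
    by rewrite -(conjg_eq1 _ g) conjXg bg2.
  have cRx := odd_cent_cyclic igG cycR nRG Gx ox.
  have Wwx : w ^ x \in W by rewrite memJ_norm // (subsetP (normal_norm nsWG)).
  pose r := w ^ x * w^-1.
  have Rr : r \in R.
    apply: Wsplit => //; apply: contra nAw => Awx.
    suff : w \in R by case/setIP.
    by rewrite -(memJ_norm w (subsetP nRG x Gx)) inE Wwx.
  have rx : r ^ x = r by apply/conjg_fixP/commgP/commute_sym/(centP cRx).
  (* Iterating x a number of times equal to its order returns to w. *)
  have iter k : w ^ (x ^+ k) = r ^+ k * w.
    elim: k => [|k IHk]; first by rewrite conjg1 mul1g.
    by rewrite expgSr conjgM IHk conjMg conjXg rx expgSr -mulgA mulgKV.
  have r1 : r = 1.
    have := iter #[x]; rewrite expg_order conjg1 => /esym/(canRL (mulgK _)).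
    rewrite mulgV => rk; apply/eqP; rewrite -order_eq1 -dvdn1.
    have co : coprime #[r] #[x].
      rewrite coprime_sym (@pnat_coprime 2^') ?pnatNK -?odd_2'nat //.
      exact: mem_p_elt pW (subsetP sRW r Rr).
    by rewrite -(Gauss_dvdl _ co) mul1n order_dvdn rk.
  have wx : w ^ x = w by rewrite -[LHS](mulgKV w) -/r r1 mul1g.
  apply/centP=> z Wz.
  have cwx : commute x w by apply/commute_sym/commgP/conjg_fixP.
  have [Az | nAz] := boolP (z \in <[a]>).
    by apply: (centP cRx); rewrite inE Wz.
  rewrite -(mulgKV w z); apply: commuteM => //.
  by apply: (centP cRx); apply: Wsplit.
have [b1 | b1] := eqVneq b 1.
  left; apply: cycW_Hall; apply: cyclicS (cycle_cyclic w).
  apply/subsetP=> z Wz.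
  have [Az | nAz] := boolP (z \in <[a]>).
    have: z \in R by rewrite inE Wz.
    by rewrite defR b1 cycle1 => /set1P->.
  have := Wsplit z Wz nAz; rewrite defR b1 cycle1 => /set1P zw.
  by rewrite -(mulgKV w z) zw mul1g cycle_id.
have ob : #[b] = 2 by apply: nt_prime_order.
have defW : W = <<[set w; b]>>.
  apply/eqP; rewrite eq_sym eqEsubset gen_subG subUset !sub1set Ww Wb /=.
  have Hw : w \in <<[set w; b]>> by rewrite mem_gen // !inE eqxx.
  have sRH : R \subset <<[set w; b]>>.
    by rewrite defR cycle_subG mem_gen // !inE eqxx orbT.
  apply/subsetP=> z Wz; have [Az | nAz] := boolP (z \in <[a]>).
    by rewrite (subsetP sRH) // inE Wz.
  by rewrite -(mulgKV w z) groupM // (subsetP sRH) // Wsplit.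
have oW : #|W| = 4.
  have oR : #|R| = 2 by rewrite defR -orderE.
  have -> : 4 = (#|R| + #|R :* w|)%N by rewrite card_rcoset oR.
  rewrite -(cardsID R W) (setIidPr sRW); congr (_ + #|pred_of_set _|)%N.
  apply/setP=> z; rewrite in_setD mem_rcoset; apply/andP/idP=> [[nRz Wz] | Rzw].
    by apply: Wsplit => //; apply: contra nRz => Az; rewrite inE Wz.
  have Wz : z \in W by rewrite -(mulgKV w z) groupM // (subsetP sRW).
  split=> //; apply: contra nAw => /setIP[_ Az].
  by have [_ ] := setIP Rzw; rewrite groupMl // groupV.
right; split=> //.
  by rewrite defW; apply: is_D2_gen; rewrite // -defW oW.
apply/subsetP=> c /setIP[Tc cWc].
(* A rotation that commutes with w is also inverted by w, so it is trivial or
   the unique involution b of <[a]>. *)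
have small d : d \in <[a]> -> commute d w -> d \in W.
  move=> Ad cdw; have dV : d = d^-1.
    by rewrite -invw //; apply/esym/conjg_fixP/commgP.
  have d2 : d ^+ 2 = 1 by rewrite expgS expg1 {1}dV mulVg.
  have [-> // | d1] := eqVneq d 1.
  have od : #[d] = 2 by apply: nt_prime_order.
  have : <[d]> == <[b]> :> {set gT}.
    rewrite (eq_subG_cyclic (cycle_cyclic a)) ?cycle_subG //.
    by rewrite -!orderE od ob.
  by move/eqP=> defd; rewrite (subsetP sRW) // defR -defd cycle_id.
have ccw : commute c w by apply: (centP cWc).
have [Ac | nAc] := boolP (c \in <[a]>); first exact: small.
rewrite -(mulgKV w c) groupM //; apply: small; first exact: offw.
apply: commute_sym; apply: commuteM; first exact: commute_sym.
exact: commuteV.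
Qed.

(** * Klein groups as 2-cores *)

(** [G] acts on [W] by permuting its nontrivial elements. *)
Lemma index_cent_dvd_fact gT (G W : {group gT}) :
  G \subset 'N(W) -> #|G : 'C_G(W)| %| (#|W|.-1)`!.
Proof.
move=> nWG; have -> : #|W|.-1 = #|W^#| by rewrite (cardsD1 1 W) group1.
rewrite -card_perm -cardsE -/(perm.Sym _).
have <- : #|conj_aut W @* G| = #|G : 'C_G(W)|.
  by rewrite card_morphim (setIidPr nWG) ker_conj_aut indexgI.
apply: (cardSg (G := perm.Sym_group W^#)) => /=.
apply: subset_trans (Aut_conj_aut _ _) _.
apply/subsetP=> f AutWf; rewrite inE; apply/subsetP=> x; rewrite !inE.
apply: contraR; rewrite negb_and negbK => /orP[/eqP-> | nWx].
  by rewrite -(autmE AutWf) morph1.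
by rewrite (out_Aut AutWf).
Qed.

(** The centralizer of the 2-core has the 2-core itself as Sylow 2-subgroup
and all its elements of odd order in the odd core, so it is their product. Its
index divides 6, and 3 is impossible because a nontrivial group of odd order
is not generated by involutions. *)
Lemma klein_core_dichotomy gT (G T : {group gT}) :
    involution_generated G -> solvable G ->
    (forall (p : nat) (P : {group gT}),
       prime p -> odd p -> p.-Sylow(G) P -> cyclic P) ->
    2.-Sylow(G) T -> #|'O_2(G)| = 4 -> 'C_T('O_2(G)) \subset 'O_2(G) ->
  2^'.-Hall(G) 'O_2^'(G) \/
  'C_G('O_2(G)) = 'O_2^'(G) * 'O_2(G) /\ #|G| = (24 * #|'O_2^'(G)|)%N.
Proof.
move=> igG solG cycSyl sylT oW sCTW.
have [cycO key] := odd_core_cyclic igG solG cycSyl.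
pose W := 'O_2(G)%G; pose O := 'O_2^'(G)%G; pose C := 'C_G(W)%G.
have nsWG : W <| G := pcore_normal _ _.
have sWG := normal_sub nsWG.
have nsCG : C <| G by rewrite norm_normalI // norms_cent // normal_norm.
have cOW : O \subset 'C(W) := pcore_pcoreC_cent 2 G.
have tiOW : O :&: W = 1 by rewrite setIC (coprime_TIg (coprime_pcoreC 2 G G)).
have oOW : #|O * W| = (4 * #|O|)%N by rewrite TI_cardMg // [#|W|]oW mulnC.
have sOWC : O * W \subset C.
  rewrite subsetI mul_subG ?pcore_sub //= mul_subG //.
  by rewrite -/(abelian W) (card_p2group_abelian (p := 2)).
have defC : C :=: O * W.
  apply/eqP; rewrite eq_sym eqEcard sOWC oOW.
  have sylC := Hall_setI_normal nsCG sylT.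
  have [K hallK] := Hall_exists 2^' (solvableS (normal_sub nsCG) solG).
  rewrite -(partnC 2 (cardG_gt0 C)) -(card_Hall sylC).
  rewrite -(card_Hall hallK) leq_mul //.
    rewrite -oW subset_leq_card // (subset_trans _ sCTW) //.
    by apply/subsetP=> x /setIP[Tx /setIP[_ cWx]]; apply/setIP.
  apply/subset_leq_card/subsetP=> x Kx.
  have /setIP[Gx cWx] := subsetP (pHall_sub hallK) x Kx.
  apply: key => //; rewrite odd_2'nat; exact: mem_p_elt (pHall_pgroup hallK) Kx.
have oG : #|G| = (4 * #|G : C| * #|O|)%N.
  by rewrite -(Lagrange (normal_sub nsCG)) defC oOW -mulnA mulnAC mulnA.
have iGC : #|G : C| %| 6.
  by have := index_cent_dvd_fact (normal_norm nsWG); rewrite oW.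
have hall2 : 2.-nat #|G : C| -> 2^'.-Hall(G) O.
  move=> p2; rewrite pHallE pcore_sub oG.
  rewrite partnM ?muln_gt0 ?cardG_gt0 ?indexg_gt0 //.
  rewrite part_p'nat ?mul1n; last by rewrite pnatNK pnatM p2.
  by rewrite part_pnat_id ?eqxx //; apply: (pcore_pgroup 2^' G).
move: iGC; rewrite dvdn_divisors //.
rewrite (_ : divisors 6 = [:: 1; 2; 3; 6]%N) // !inE.
case/or4P=> /eqP i.
- by left; apply: hall2; rewrite i.
- by left; apply: hall2; rewrite i.
- have := quotient_involution_generated (normal_norm nsCG) igG.
  move/involution_generated_odd.
  rewrite /= card_quotient ?normal_norm // i.
  move/(_ isT)/(congr1 (fun A : {set _} => #|A|)).
  by rewrite cards1 card_quotient ?normal_norm // i.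
- by right; split; rewrite ?oG ?i.
Qed.

(** * Cyclic odd group extended by a dihedral 2-group *)

(** The order hypothesis says that the dihedral group generated by [k] and [v]
does not collapse modulo [N]. *)
Lemma is_D2_quotient gT (N : {group gT}) (k v : gT) :
    k \in 'N(N) -> v \in 'N(N) -> v ^+ 2 = 1 -> k ^ v = k^-1 ->
    #|(<[k]> <*> <[v]>) / N| = (2 * #[k])%N ->
  is_D2 #[k] ((<[k]> <*> <[v]>) / N).
Proof.
move=> Nk Nv v2 kv; rewrite quotientY ?cycle_subG // !quotient_cycle //.
rewrite -gen_mulg_pair -morphM // mul2n => oP.
apply: is_D2_gen oP; rewrite ?order_gt0 // -morphX ?groupM //.
  by rewrite v2 morph1.
by rewrite sqr_mulg_inverted // morph1.
Qed.

(** With reflections [u], [v] such that [a = u * v] generates the rotations of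
[T], the group [O] is the direct product of [A] (centralized by [u], inverted
by [v]), [C] (inverted by [u], centralized by [v]) and [D] (inverted by both).
The square of [a] centralizes [O], so [N = D * <[a ^+ 2]>] is cyclic and
normal, and modulo [N] the dihedral groups [A <*> <[v]>] and [C <*> <[u]>]
commute, as [u] and [v] do. The parameters are [m = #|D|], [n = #|A|] and
[l = #|C|]. *)
Lemma dihedral_Sylow2_split gT (G O T : {group gT}) k :
    involution_generated G -> cyclic O -> odd #|O| -> 2.-Sylow(G) T ->
    O ><| T = G -> 1 < k -> is_D2 k T ->
  exists m n l e : nat,
    [/\ [/\ odd m, odd n & odd l],
        [/\ coprime m n, coprime m l & coprime n l], 2 <= e,
        (exists A B : {group gT},
           [/\ cyclic A /\ #|A| = (m * n * l)%N, B \isog 'D_(2 ^ e)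
             & A ><| B = G])
      & (exists N : {group gT},
           [/\ N <| G, cyclic N, #|N| = (2 ^ (e - 2) * m)%N
             & exists P Q : {group coset_of N},
                 [/\ is_D2 n P, is_D2 l Q & P \x Q = G / N]])].
Proof.
move=> igG cycO oddO sylT defG k_gt1 dihT.
have [nsOG sTG defOT nOT tiOT] := sdprod_context defG.
have [sOG nOG] := andP nsOG.
have abO := cyclic_abelian cycO.
have oT : #|T| = k.*2 by rewrite (is_D2_card _ dihT) // ltnW.
have [e2 oTe] := p_natP (pHall_pgroup sylT).
have [e e_def] : exists e, e2 = e.+2.
  case: e2 oTe => [|[|e]] oTe; last by exists e.
    by move: k_gt1; rewrite -(ltn_double 1) -oT oTe.
  by move: k_gt1; rewrite -(ltn_double 1) -oT oTe.
subst e2.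
have k_def : k = (2 ^ e.+1)%N by apply: double_inj; rewrite -oT oTe expnS mul2n.
have isoT : T \isog 'D_(2 ^ e.+2).
  by move: dihT; rewrite /is_D2 (gtn_eqF k_gt1) -oT oTe.
have [a [u [defT oa u2 au]]] := is_D2_presentation k_gt1 dihT.
pose v := u * a.
have Tu : u \in T by rewrite -defT mem_gen // inE cycle_id orbT.
have Ta : a \in T by rewrite -defT mem_gen // inE cycle_id.
have Tv : v \in T by rewrite groupM.
have v2 : v ^+ 2 = 1 by apply: sqr_mulg_inverted.
have defa : a = u * v by rewrite mulgA -expg2 u2 mul1g.
have charO (A : {group gT}) : A \subset O -> G \subset 'N(A).
  by move=> sAO; apply: char_norm_trans nOG; rewrite sub_cyclic_char.
have nT x (A : {group gT}) : x \in T -> A \subset O -> x \in 'N(A).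
  by move=> Tx sAO; rewrite (subsetP (charO A sAO)) // (subsetP sTG).
have oddS (A : {group gT}) : A \subset O -> odd #|A|.
  by move/cardSg=> dvdA; apply: dvdn_odd dvdA oddO.
have cycS (A : {group gT}) : A \subset O -> cyclic A by move/cyclicS->.
have [_ defRO] :=
  involution_generated_sdprod igG sylT defG (subxx T) (fun t Tt _ => Tt).
have coOT : coprime #|O| #|T|.
  by rewrite oTe coprime_sym coprimeXl ?coprime2n.
(* This is where the part of O centralized by T disappears: O is generated by
   commutators with T. *)
have tiCOT : 'C_O(T) = 1 by rewrite -{1}defRO coprime_abel_cent_TI.
have := cent_inverted_dprod abO oddO (nT u O Tu (subxx _)) u2.
case/dprodP=> [[A B defA defB]]; rewrite defA defB => defAB cAB tiAB.
have sAO : A \subset O by rewrite -defA subsetIl.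
have sBO : B \subset O.
  by rewrite -defB; apply/subsetP=> x; rewrite inE => /andP[].
have := cent_inverted_dprod (abelianS sAO abO) (oddS A sAO) (nT v A Tv sAO) v2.
have -> : 'C_A[v] = 1.
  apply/trivgP; rewrite -tiCOT; apply/subsetP=> x /setIP[Ax /cent1P cvx].
  have /setIP[Ox /cent1P cux] : x \in 'C_O[u] by rewrite defA.
  apply/setIP; split=> //; rewrite -defT centY !cent_cycle.
  apply/setIP; split; apply/cent1P => //.
  by rewrite defa; apply: commuteM.
rewrite dprod1g => invA.
have := cent_inverted_dprod (abelianS sBO abO) (oddS B sBO) (nT v B Tv sBO) v2.
case/dprodP=> [[C D defC defD]]; rewrite defC defD => defCD cCD tiCD.
have sCB : C \subset B by rewrite -defC subsetIl.
have sDB : D \subset B.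
  by rewrite -defD; apply/subsetP=> x; rewrite inE => /andP[].
have [sCO sDO] := (subset_trans sCB sBO, subset_trans sDB sBO).
have oB : #|B| = (#|C| * #|D|)%N by rewrite -defCD TI_cardMg.
have oO : #|O| = (#|A| * #|B|)%N by rewrite -defAB TI_cardMg.
have coAB : coprime #|A| #|B|.
  by rewrite -(cyclic_dprod (etrans (dprodE cAB tiAB) defAB)) ?cycS.
have coCD : coprime #|C| #|D|.
  by rewrite -(cyclic_dprod (etrans (dprodE cCD tiCD) defCD)) ?cycS.
move: (coAB); rewrite oB coprimeMr => /andP[coAC coAD].
pose Z := <[a ^+ 2]>%G.
have sZT : Z \subset T by rewrite cycle_subG groupX.
have cOZ : Z \subset 'C(O).
  rewrite cycle_subG (subsetP (der1_cent_cyclic cycO nOG)) //.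
  by rewrite sqr_in_der1 // (subsetP sTG).
have oZ : #|Z| = (2 ^ e)%N.
  by rewrite -orderE orderXdiv oa k_def ?expnS ?dvdn_mulr // mulKn.
pose N := (D <*> Z)%G.
have cDZ : Z \subset 'C(D) by rewrite (subset_trans cOZ) // centS.
have defN : N :=: D * Z by rewrite /= cent_joinEr.
have coDZ : coprime #|D| #|Z|.
  by apply: coprimeSg sDO _; apply: coprimegS sZT _.
have oN : #|N| = (2 ^ e * #|D|)%N by rewrite defN coprime_cardMg // oZ mulnC.
have cycN : cyclic N by rewrite defN cyclicM ?cycle_cyclic ?cycS.
have nZG : G \subset 'N(Z).
  rewrite -defOT mul_subG //; first by rewrite cents_norm // centsC.
  apply: (char_norm_trans (G := <[a]>)).
    by rewrite sub_cyclic_char ?cycle_cyclic // cycle_subG mem_cycle.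
  rewrite -defT join_subG normG cycle_subG.
  by apply/normP; rewrite -cycleJ au cycleV.
have sNG : N \subset G.
  by rewrite join_subG (subset_trans sDO) ?(subset_trans sZT).
have nNG : G \subset 'N(N) by apply: normsY => //; apply: charO.
have nsNG : N <| G by apply/andP.
have oGN : #|G / N| = (4 * #|A| * #|C|)%N.
  rewrite card_quotient // -divgS // -(sdprod_card defG) oTe oO oB oN.
  have -> : (#|A| * (#|C| * #|D|) * 2 ^ e.+2
             = 4 * #|A| * #|C| * (2 ^ e * #|D|))%N.
    rewrite (expnD 2 2 e) (mulnA #|A|) -mulnA (mulnCA #|D|) mulnCA.
    by rewrite (mulnC #|D|) !mulnA.
  by rewrite mulnK // muln_gt0 expn_gt0 cardG_gt0.
have [c defc] := cyclicP (cycS C sCO).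
have [b defb] := cyclicP (cycS A sAO).
have Ab : b \in A by rewrite defb cycle_id.
have Cc : c \in C by rewrite defc cycle_id.
have bv : b ^ v = b^-1 by apply/eqP; move: Ab; rewrite -invA inE => /andP[].
have cu : c ^ u = c^-1.
  by apply/eqP; move: (subsetP sCB c Cc); rewrite -defB inE => /andP[].
have Gu : u \in G := subsetP sTG u Tu.
have Gv : v \in G := subsetP sTG v Tv.
pose P := (A <*> <[v]>)%G; pose Q := (C <*> <[u]>)%G.
have nNA : A \subset 'N(N) := subset_trans sAO (subset_trans sOG nNG).
have nNC : C \subset 'N(N) := subset_trans sCO (subset_trans sOG nNG).
have [Nu Nv] := (subsetP nNG u Gu, subsetP nNG v Gv).
have nNu : <[u]> \subset 'N(N) by rewrite cycle_subG.
have nNv : <[v]> \subset 'N(N) by rewrite cycle_subG.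
have leP : #|P / N| <= 2 * #|A|.
  rewrite (leq_trans (leq_quotient _ _)) //= norm_joinEr ?cycle_subG ?nT //.
  rewrite mulnC (leq_trans (dvdn_leq _ (dvdn_cardMg _ _))) ?muln_gt0
          ?cardG_gt0 //.
  by rewrite leq_mul // dvdn_leq // order_dvdn v2.
have leQ : #|Q / N| <= 2 * #|C|.
  rewrite (leq_trans (leq_quotient _ _)) //= norm_joinEr ?cycle_subG ?nT //.
  rewrite mulnC (leq_trans (dvdn_leq _ (dvdn_cardMg _ _))) ?muln_gt0
          ?cardG_gt0 //.
  by rewrite leq_mul // dvdn_leq // order_dvdn u2.
have cPQ : Q / N \subset 'C(P / N).
  rewrite /= !quotientY // centY subsetI !join_subG.
  have cCA : C \subset 'C(A).
    by rewrite (subset_trans sCO) // (subset_trans abO) // centS.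
  have cCv : C \subset 'C(<[v]>) by rewrite -defC cent_cycle subsetIr.
  have cAu : <[u]> \subset 'C(A) by rewrite centsC cent_cycle -defA subsetIr.
  rewrite (quotient_cents _ cCA) (quotient_cents _ cCv).
  rewrite (quotient_cents _ cAu) /=.
  rewrite !quotient_cycle // cycle_subG /= cent_cycle.
  apply/cent1P; rewrite /commute -!morphM //.
  have -> : v * u = u * v * (a ^+ 2)^-1.
    rewrite -defa expgS expg1 invMg mulKVg.
    by rewrite -mulgA (conjgC a u) au mulgA -expg2 u2 mul1g.
  have coa : coset N (a ^+ 2)^-1 = 1.
    by rewrite coset_id // groupV mem_gen // inE cycle_id orbT.
  have Na : (a ^+ 2)^-1 \in 'N(N).
    by rewrite groupV groupX // (subsetP nNG) ?(subsetP sTG).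
  rewrite (morphM (coset_morphism N) (groupM Nu Nv) Na).
  by have -> : coset_morphism N (a ^+ 2)^-1 = 1 := coa; rewrite mulg1.
have sPQG : P <*> Q \subset G.
  rewrite !join_subG !cycle_subG Gu Gv.
  by rewrite (subset_trans sAO) ?(subset_trans sCO).
have defPQ : (P / N) * (Q / N) = G / N.
  have nNP : P \subset 'N(N) by rewrite join_subG nNA.
  have nNQ : Q \subset 'N(N) by rewrite join_subG nNC.
  rewrite -cent_joinEr // -quotientY //.
  apply/eqP; rewrite eqEsubset quotientS //=.
  rewrite -(quotientYidr (G := (P <*> Q)%G)) ?(subset_trans sPQG) //.
  apply: quotientS; rewrite -{1}defOT.
  set L := (_ <*> N); have sPQL : P <*> Q \subset L := joing_subl _ _.
  have sPL : P \subset L := subset_trans (joing_subl _ _) sPQL.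
  have sQL : Q \subset L := subset_trans (joing_subr _ _) sPQL.
  have sNL : N \subset L := joing_subr _ _.
  have Lu : u \in L by rewrite (subsetP sQL) // mem_gen // inE cycle_id orbT.
  have Lv : v \in L by rewrite (subsetP sPL) // mem_gen // inE cycle_id orbT.
  apply: mul_subG; last by rewrite -defT join_subG !cycle_subG defa groupM.
  rewrite -defAB; apply: mul_subG.
    exact: subset_trans (joing_subl _ _) sPL.
  rewrite -defCD; apply: mul_subG.
    exact: subset_trans (joing_subl _ _) sQL.
  exact: subset_trans (joing_subl _ _) sNL.
have e4 : (2 * #|A| * (2 * #|C|) = 4 * #|A| * #|C|)%N by rewrite mulnACA mulnA.
have dPQ : (P / N) \x (Q / N) = G / N.
  apply: cprod_card_dprod; first exact: etrans (cprodE cPQ) defPQ.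
  by rewrite oGN (leq_trans (leq_mul leP leQ)) ?e4.
have := dprod_card dPQ; rewrite oGN => oPQ.
(* The upper bounds leP and leQ multiply to the order of G / N, so both are
   attained. *)
have [oP oQ] : #|P / N| = (2 * #|A|)%N /\ #|Q / N| = (2 * #|C|)%N.
  split; apply/eqP; rewrite eqn_leq ?leP ?leQ /=.
    rewrite -(leq_pmul2r (m := 2 * #|C|)) ?muln_gt0 ?cardG_gt0 //.
    by rewrite e4 -oPQ leq_mul2l leQ orbT.
  rewrite -(leq_pmul2l (m := 2 * #|A|)) ?muln_gt0 ?cardG_gt0 //.
  by rewrite e4 -oPQ leq_mul2r leP orbT.
exists #|D|, #|A|, #|C|, e.+2; split=> //.
- by rewrite !oddS.
- rewrite [coprime #|D| _]coprime_sym coAD.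
  by rewrite [coprime #|D| _]coprime_sym coCD coAC.
- exists O, T; split=> //; split=> //.
  by rewrite oO oB mulnA mulnC mulnA.
exists N; split=> //; first by rewrite oN subSS subn1.
exists (P / N)%G, (Q / N)%G; split=> //=.
  move: oP; rewrite /= defb => oP.
  by apply: is_D2_quotient => //; apply: (subsetP nNA).
move: oQ; rewrite /= defc => oQ.
by apply: is_D2_quotient => //; apply: (subsetP nNC).
Qed.

(** * Extensions with quotient S_4 *)

(** Numbering the points of [S] turns the action into permutations of ordinals;
only elements of [G] preserve [S], hence the default value in [h]. *)
Lemma acts_perm_morphism (aT : finGroupType) (D G : {group aT}) (rT : finType)
    (to : action D rT) (S : {set rT}) n :
    [acts G, on S | to] -> #|S| = n ->
  exists f : {morphism G >-> 'S_n}, 'ker f = 'C_G(S | to).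
Proof.
move=> actsGS; have sGD := acts_dom actsGS.
move=> oS; subst n.
pose F (i : 'I_#|S|) : rT := enum_val i.
have FS i : F i \in S := enum_valP i.
have injF : injective F by apply: enum_val_inj.
pose isrep (g : aT) (s : 'S_#|S|) := [forall i, F (s i) == to (F i) g].
pose h (g : aT) : 'S_#|S| := odflt 1 [pick s | isrep g s].
have hP g i : g \in G -> F (h g i) = to (F i) g.
  move=> Gg; rewrite /h; case: pickP => [s /forallP/(_ i)/eqP // | none].
  have Sg j : to (F j) g \in S by rewrite (acts_act actsGS).
  pose r (j : 'I_#|S|) := enum_rank_in (FS j) (to (F j) g).
  have rK j : F (r j) = to (F j) g by apply: enum_rankK_in.
  have injr : injective r.
    by move=> j1 j2 /(congr1 F); rewrite !rK => /act_inj/injF.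
  by have /negP[] := none (perm injr); apply/forallP=> j; rewrite permE rK.
have hM : {in G &, {morph h : x y / x * y}}.
  move=> x y Gx Gy; apply/permP=> i; apply: injF.
  by rewrite permM !hP ?groupM // actMin ?(subsetP sGD).
exists (Morphism hM); apply/setP=> g; rewrite !inE /=.
apply: andb_id2l => Gg; rewrite (subsetP sGD) //=.
apply/eqP/subsetP=> [h1 x Sx | fixS].
  by rewrite inE -(enum_rankK_in Sx Sx) -[enum_val _]/(F _) -hP // h1 perm1.
apply/permP=> i; apply: injF; rewrite hP // perm1.
by have := fixS _ (FS i); rewrite inE => /eqP.
Qed.

(** The product of [V] and [P] has index 2, so it is normal, and the Frattini
argument applied to its Sylow subgroup [P] gives [V * 'N_K(P) = K]. By
coprimality an element of [V] that normalizes [P] centralizes it. *)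
Lemma sdprod_normalizer_Sylow gT (K V P : {group gT}) p :
    V <| K -> p.-Sylow(K) P -> p^'.-group V -> #|K| = (#|V| * #|P| * 2)%N ->
    'C_V(P) = 1 ->
  V ><| 'N_K(P) = K.
Proof.
move=> nsVK sylP p'V oK tiC; have [sVK nVK] := andP nsVK.
have sPK := pHall_sub sylP; have nVP := subset_trans sPK nVK.
have coVP : coprime #|V| #|P|.
  by rewrite coprime_sym (pnat_coprime (pHall_pgroup sylP)).
have oVP : #|V <*> P| = (#|V| * #|P|)%N.
  by rewrite norm_joinEr // coprime_cardMg.
have sVPK : V <*> P \subset K by rewrite join_subG sVK.
have nsVPK : V <*> P <| K.
  apply: index2_normal => //; rewrite -divgS //= oVP oK mulKn //.
  by rewrite muln_gt0 !cardG_gt0.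
have sylPV : p.-Sylow(V <*> P) P by apply: pHall_subl sylP; rewrite ?joing_subr.
have := Frattini_arg nsVPK sylPV; rewrite /= norm_joinEr // -mulgA.
have sPN : P \subset 'N_K(P) by rewrite subsetI sPK normG.
rewrite mulSGid // => defK.
rewrite sdprodE ?(subset_trans (subsetIl _ _)) //.
by rewrite setIA (setIidPl sVK) coprime_norm_cent.
Qed.

(** The number of fixed points divides 4 and is congruent to 4 modulo 3, so it
is 1 or 4. *)
Lemma fixed_point_free_klein gT (W P : {group gT}) :
    3.-group P -> P \subset 'N(W) -> #|W| = 4 -> ~~ (P \subset 'C(W)) ->
  'C_W(P) = 1.
Proof.
move=> pP nWP oW ncWP.
have := pgroup_fix_mod (to := 'J) pP (S := W).
rewrite astabsJ nWP afixJ oW => /(_ isT) modW.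
have : #|'C_W(P)| %| 4 by rewrite -oW cardSg // subsetIl.
rewrite dvdn_divisors // (_ : divisors 4 = [:: 1; 2; 4]%N) // !inE.
case/or3P=> /eqP oC; first exact: card1_trivg.
  by rewrite oC in modW.
case/negP: ncWP; rewrite centsC; apply/setIidPl/eqP.
by rewrite eqEcard subsetIl oC oW.
Qed.

(** The 3'-part [B] of the odd core [O] is a normal Hall subgroup, so it has a
complement [H] by the Schur-Zassenhaus theorem, and the normalizer [C] in [H] of
a Sylow 3-subgroup [P] complements the Klein group [W] in [H]. Then [C] is a
quotient of [G], so it is generated by involutions and dihedral. The group
[G] acts on the four cosets of [L = B * C]. The kernel of this action meets
[W] trivially, hence centralizes it and lies in [O * W]; since it contains
[O], it is [O]. *)
Lemma klein_core_structure gT (G : {group gT}) :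
    involution_generated G -> cyclic 'O_2^'(G) ->
    (forall (p : nat) (P : {group gT}),
       prime p -> odd p -> p.-Sylow(G) P -> cyclic P) ->
    #|'O_2(G)| = 4 -> is_D2 2 'O_2(G) ->
    'C_G('O_2(G)) = 'O_2^'(G) * 'O_2(G) -> #|G| = (24 * #|'O_2^'(G)|)%N ->
  exists n f : nat,
    [/\ coprime n 6,
        (exists A B C : {group gT},
           [/\ A \isog 'D_4, cyclic B /\ #|B| = n,
               C \isog 'D_(2 * 3 ^ f.+1) & (A \x B) ><| C = G])
      & (exists N : {group gT},
           [/\ N <| G, cyclic N, #|N| = (3 ^ f * n)%N
             & G / N \isog [set: 'S_4]])].
Proof.
move=> igG cycO cycSyl oW dihW cGW oG.
pose W := 'O_2(G)%G; pose O := 'O_2^'(G)%G.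
have nsWG : W <| G := pcore_normal _ _; have nsOG : O <| G := pcore_normal _ _.
have [sWG nWG] := andP nsWG; have [sOG nOG] := andP nsOG.
have nilO : nilpotent O := abelian_nil (cyclic_abelian cycO).
pose B := 'O_3^'(O)%G; pose R := 'O_3(O)%G.
have nsBG : B <| G by apply: gFnormal_trans.
have nsRG : R <| G by apply: gFnormal_trans.
have [sBG nBG] := andP nsBG.
have sBO : B \subset O := pcore_sub _ _.
pose n := #|B|; pose f := logn 3 #|O|.
have oR : #|R| = (3 ^ f)%N.
  by rewrite (card_Hall (nilpotent_pcore_Hall 3 nilO)) p_part.
have defO : R \x B = O := nilpotent_pcoreC 3 nilO.
have oO : #|O| = (3 ^ f * n)%N by rewrite -(dprod_card defO) oR.
have oddO : odd #|O| by rewrite odd_2'nat; apply: pcore_pgroup.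
have oddn : odd n := dvdn_odd (cardSg sBO) oddO.
have co3n : coprime 3 n.
  by rewrite (pnat_coprime (pi := 3)) ?pnat_id //; apply: (pcore_pgroup 3^' O).
have con6 : coprime n 6.
  by rewrite (coprimeMr n 2 3) coprimen2 oddn coprime_sym.
have oG' : #|G| = (n * (24 * 3 ^ f))%N by rewrite oG oO mulnA mulnC.
have iB : #|G : B| = (24 * 3 ^ f)%N by rewrite -divgS // oG' mulKn ?cardG_gt0.
have hallB : Hall G B.
  have [con2 con3] : coprime n 2 /\ coprime n 3.
    by rewrite coprimen2 coprime_sym.
  rewrite /Hall sBG iB (_ : 24 = 2 ^ 3 * 3)%N // !coprimeMr.
  by rewrite !coprimeXr -/n ?con2 ?con3.
have /splitsP[H /complP[tiBH defG]] := SchurZassenhaus_split hallB nsBG.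
have sHG : H \subset G by rewrite -defG mulG_subr.
have oH : #|H| = (24 * 3 ^ f)%N.
  by apply/eqP; rewrite -(eqn_pmul2l (cardG_gt0 B)) -TI_cardMg // defG oG'.
have sylGH (p : nat) (S : {group gT}) :
    p^'.-nat n -> p.-Sylow(H) S -> p.-Sylow(G) S.
  move=> p'n sylS; rewrite pHallE (subset_trans (pHall_sub sylS)) //=.
  rewrite (card_Hall sylS) oG' -oH partnM ?cardG_gt0 //.
  by rewrite (part_p'nat (n := n)) ?mul1n //.
have [T sylT] := Sylow_exists 2 H; have [P sylP] := Sylow_exists 3 H.
have sylTG : 2.-Sylow(G) T by apply: sylGH sylT; rewrite -odd_2'nat.
have sylPG : 3.-Sylow(G) P by apply: sylGH sylP; apply: (pcore_pgroup 3^' O).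
have sWH : W \subset H := subset_trans (pcore_sub_Hall sylTG) (pHall_sub sylT).
have sPH := pHall_sub sylP; have sPG := pHall_sub sylPG.
have oP : #|P| = (3 ^ f.+1)%N.
  rewrite (card_Hall sylP) oH p_part; congr (_ ^ _)%N.
  by rewrite (lognM 3 (_ : 0 < 24)) ?expn_gt0 // pfactorK.
have cycP : cyclic P by apply: cycSyl sylPG.
(* Otherwise P would lie in O * W, whose 3-part is smaller by a factor 3. *)
have ncWP : ~~ (P \subset 'C(W)).
  apply/negP=> cWP; have : P \subset 'C_G(W) by rewrite subsetI sPG.
  move/cardSg; rewrite /= cGW oP TI_cardMg; last first.
    by rewrite setIC (coprime_TIg (coprime_pcoreC 2 G G)).
  rewrite oW -/O pfactor_dvdn ?muln_gt0 ?cardG_gt0 //.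
  by rewrite lognM ?cardG_gt0 // addn0 ltnn.
have tiWP := fixed_point_free_klein (pHall_pgroup sylP)
               (subset_trans sPG nWG) oW ncWP.
have oW4 : #|W| = 4 := oW.
pose C := 'N_H(P)%G.
have defH : W ><| C = H.
  apply: (sdprod_normalizer_Sylow _ sylP _ _ tiWP) => //.
  - exact: normalS sWH sHG nsWG.
  - by rewrite /pgroup oW4.
  - by rewrite oP oW4 oH expnS !mulnA [RHS]mulnAC.
have [_ sCH mulWC _ tiWC] := sdprod_context defH.
have oC : #|C| = (#|P| * 2)%N.
  apply/eqP; rewrite -(eqn_pmul2l (cardG_gt0 W)) (sdprod_card defH).
  rewrite oH oW4 oP expnS.
  by rewrite -[24]/(4 * (3 * 2))%N -mulnA mulnAC.
have cWB : B \subset 'C(W) := subset_trans sBO (pcore_pcoreC_cent 2 G).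
have tiWB : W :&: B = 1.
  by apply/trivgP; rewrite -(coprime_TIg (coprime_pcoreC 2 G G)) setIS.
have dWB := dprodE cWB tiWB.
pose M := (W <*> B)%G.
have defM : M :=: W * B by rewrite /= cent_joinEr.
have oM : #|M| = (4 * n)%N by rewrite defM TI_cardMg // oW4.
have nsMG : M <| G by rewrite normalY.
have defMC : M * C = G.
  by rewrite defM -(centC cWB) -mulgA mulWC.
have tiMC : M :&: C = 1.
  apply: card1_trivg; apply/eqP; rewrite -(eqn_pmul2l (cardG_gt0 G)) muln1.
  rewrite -{1}defMC -mul_cardG oM oC oG' oP expnS.
  by rewrite -[24]/(4 * (3 * 2))%N -!mulnA mulnCA [(2 * _)%N]mulnC.
have sCG : C \subset G := subset_trans sCH sHG.
have sdMC : M ><| C = G.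
  by rewrite sdprodE // (subset_trans sCG) // normal_norm.
have igC : involution_generated C.
  apply: isog_involution_generated
           (quotient_involution_generated (normal_norm nsMG) igG).
  by rewrite isog_sym; apply: sdprod_isog.
have nsPC : P <| C by apply: normalSG.
have dihC : is_D2 #|P| C.
  apply: odd_normal_cyclic_index2_dihedral => //.
  by rewrite oP oddX orbT.
exists n, f; split=> //.
  exists W, B, C; split=> //.
  - by split=> //; apply: cyclicS cycO.
  - move: dihC; rewrite /is_D2 oP mul2n.
    by case: eqP => // /eqP; rewrite -[1%N](expn0 3) eqn_exp2l.
  by rewrite dWB -defM.
exists O; split=> //.
pose L := (B <*> C)%G.
have defL : L :=: B * C by rewrite /= norm_joinEr // (subset_trans sCG).
have sLG : L \subset G by rewrite join_subG sBG.
have defLW : L * W = G.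
  by rewrite defL -mulgA (normC (subset_trans sCG nWG)) mulWC.
have oL : #|L| = (n * (#|P| * 2))%N.
  rewrite defL TI_cardMg ?oC //; apply/trivgP; rewrite -tiBH; exact: setIS.
have iL : #|G : L| = 4.
  rewrite -divgS // oL oP oG' expnS.
  have -> : (n * (24 * 3 ^ f) = 4 * (n * (3 * 3 ^ f * 2)))%N.
    by rewrite [RHS]mulnCA -[24]/(4 * (3 * 2))%N -!mulnA [(2 * _)%N]mulnC.
  by rewrite mulnK // !muln_gt0 expn_gt0 cardG_gt0.
have tiLW : L :&: W = 1.
  apply: card1_trivg; apply/eqP; rewrite -(eqn_pmul2l (cardG_gt0 G)) muln1.
  by rewrite -{1}defLW -mul_cardG -(Lagrange sLG) iL oW4.
have [h kerh] := acts_perm_morphism (actsRs_rcosets L G) iL.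
rewrite astabRs_rcosets in kerh.
have sOL : O \subset L.
  rewrite -(dprodW defO) mul_subG ?joing_subl //.
  apply: subset_trans (joing_subr _ _); apply: subset_trans (normal_sub nsPC).
  apply: subset_trans (pcore_sub_Hall sylPG); apply: pcore_max nsRG.
  exact: pcore_pgroup.
have kerO : 'ker h = O.
  rewrite kerh; apply/eqP; rewrite eqEsubset subsetI sOG /= gcore_max // andbT.
  apply/subsetP=> x /setIP[Gx Rx].
  have tiRW : gcore L G :&: W = 1.
    by apply/trivgP; rewrite -tiLW setSI // gcore_sub.
  have : x \in 'C_G(W).
    rewrite inE Gx /=; apply: subsetP Rx; apply/commG1P/trivgP; rewrite -tiRW.
    apply: commg_subI; rewrite subsetI subxx /=.
      by rewrite (subset_trans _ nWG) // (subset_trans (gcore_sub _ _)).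
    by rewrite (subset_trans sWG) // gcore_norm.
  rewrite cGW => /mulsgP[o w Oo Ww def_x].
  have Ro : o \in gcore L G by apply: subsetP Oo; apply: gcore_max.
  have : w \in gcore L G :&: W by rewrite inE Ww andbT -(groupMl w Ro) -def_x.
  by rewrite tiRW def_x => /set1P->; rewrite mulg1.
rewrite -kerO; suff <- : h @* G = [set: 'S_4] by apply: first_isog.
apply/eqP; rewrite eqEcard subsetT cardsT card_Sn /=.
by rewrite card_morphim setIid kerO -divgS // oG mulnK ?cardG_gt0.
Qed.

(** * Automorphisms of maps *)

Definition flag_vertex (M : surface_map) (f : M) : {set M} :=
  orbit 'P <<[set mt1 M; mt2 M]>> f.
Definition flag_edge (M : surface_map) (f : M) : {set M} :=
  orbit 'P <<[set mt0 M; mt2 M]>> f.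

Lemma orbit_gen_sub (M : surface_map) (A : {set {perm M}}) (S : {set M}) f :
    f \in S -> (forall p g, p \in A -> g \in S -> p g \in S) ->
  orbit 'P <<A>> f \subset S.
Proof.
move=> Sf clS; have nS : <<A>> \subset 'N(S | 'P).
  rewrite gen_subG; apply/subsetP=> p Ap; rewrite !inE /=.
  by apply/subsetP=> g Sg; rewrite inE; apply: clS.
by rewrite acts_sub_orbit.
Qed.

Lemma flag_vertex_mt1 (M : surface_map) (f : M) :
  flag_vertex (mt1 M f) = flag_vertex f.
Proof.
by apply/orbit_eqP/(mem_orbit 'P f)/mem_gen; rewrite !inE eqxx.
Qed.

Lemma flag_vertex_mt2 (M : surface_map) (f : M) :
  flag_vertex (mt2 M f) = flag_vertex f.
Proof.
by apply/orbit_eqP/(mem_orbit 'P f)/mem_gen; rewrite !inE eqxx orbT.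
Qed.

Lemma flag_edge_mt0 (M : surface_map) (f : M) :
  flag_edge (mt0 M f) = flag_edge f.
Proof.
by apply/orbit_eqP/(mem_orbit 'P f)/mem_gen; rewrite !inE eqxx.
Qed.

Lemma flag_edgeP (M : surface_map) (f g : M) :
  g \in flag_edge f ->
  [\/ g = f, g = mt0 M f, g = mt2 M f | g = mt0 M (mt2 M f)].
Proof.
have clS : flag_edge f \subset [set f; mt0 M f; mt2 M f; mt0 M (mt2 M f)].
  apply: orbit_gen_sub => [|p h]; first by rewrite !inE eqxx.
  rewrite !inE -!orbA => /orP[] /eqP-> /or4P[] /eqP->;
  by rewrite ?mt0K -?mt02C ?mt0K ?mt2K ?eqxx ?orbT // mt02C mt2K eqxx ?orbT.
by move/(subsetP clS); rewrite !inE -!orbA => /or4P[] /eqP->; 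
   [constructor 1 | constructor 2 | constructor 3 | constructor 4].
Qed.

Lemma map_aut_mt (M : surface_map) (g : {perm M}) (f : M) :
  g \in map_aut M ->
  [/\ g (mt0 M f) = mt0 M (g f), g (mt1 M f) = mt1 M (g f) &
                         g (mt2 M f) = mt2 M (g f)].
Proof. by rewrite inE => /forallP/(_ f)/and3P[/eqP ? /eqP ? /eqP ?]. Qed.

Lemma orbit_map_aut (M : surface_map) (g : {perm M}) (A : {set {perm M}})
    (f : M) :
    (forall p h, p \in A -> g (p h) = p (g h)) ->
  'P^*%act (orbit 'P <<A>> f) g = orbit 'P <<A>> (g f).
Proof.
move=> cA; have {}cA : <<A>> \subset 'C[g].
  rewrite gen_subG; apply/subsetP=> p Ap; apply/cent1P/permP=> h.
  by rewrite !permM cA.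
apply/setP=> h; apply/imsetP/orbitP=> [[k /orbitP[p Hp <-] ->] | [p Hp <-]].
  exists p => //=; rewrite /aperm -!permM.
  by have /cent1P-> := subsetP cA p Hp.
exists (p f); first by apply/orbitP; exists p.
by rewrite /= /aperm -!permM; have /cent1P-> := subsetP cA p Hp.
Qed.

Lemma act_flag_vertex (M : surface_map) (g : {perm M}) (f : M) :
  g \in map_aut M -> 'P^*%act (flag_vertex f) g = flag_vertex (g f).
Proof.
move=> autg; apply: orbit_map_aut => p h; rewrite !inE => /orP[] /eqP->;
by have [] := map_aut_mt h autg.
Qed.

Lemma act_flag_edge (M : surface_map) (g : {perm M}) (f : M) :
  g \in map_aut M -> 'P^*%act (flag_edge f) g = flag_edge (g f).
Proof.
move=> autg; apply: orbit_map_aut => p h; rewrite !inE => /orP[] /eqP->;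
by have [] := map_aut_mt h autg.
Qed.

Lemma flag_arc (M : surface_map) (f : M) :
  (flag_vertex f, flag_edge f) \in arcs M.
Proof.
rewrite inE /= !imset_f //; apply/set0Pn; exists f.
by rewrite inE !orbit_refl.
Qed.

(** Arc-transitivity gives [z] that reverses the edge of [f]. As the edge is
not a loop, [z] maps [f] to one of the two flags at its other end, and in
either case its square fixes [f], so fixes the arc and is trivial. *)
Lemma edge_swap (M : surface_map) (G : {group {perm M}}) (f : M) :
    G \subset map_aut M -> regular_on (pair_action M) G (arcs M) ->
  exists z, [/\ z \in G, z ^+ 2 = 1 &
    'P^*%act (flag_vertex f) z = flag_vertex (mt0 M f)].
Proof.
move=> autG [trG regG].
have := flag_arc (mt0 M f); rewrite flag_edge_mt0 => arc'.
have [z Gz [vz ez]] := atransP2 trG (flag_arc f) arc'.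
have autz := subsetP autG z Gz.
rewrite /= act_flag_vertex // in vz; rewrite /= act_flag_edge // in ez.
exists z; split=> //; last by rewrite act_flag_vertex.
have zz f' : z (mt0 M f') = mt0 M (z f') by case: (map_aut_mt f' autz).
have zz2 f' : z (mt2 M f') = mt2 M (z f') by case: (map_aut_mt f' autz).
have zf : z (z f) = f.
  have vf : flag_vertex (mt0 M f) <> flag_vertex f.
    move=> vf; have := m_loopless f; rewrite -/(flag_vertex f) -vf.
    by rewrite orbit_refl.
  have : z f \in flag_edge f by rewrite ez; apply: orbit_refl.
  case/flag_edgeP=> e.
  - by case: vf; rewrite vz e.
  - by rewrite e zz e mt0K.
  - by case: vf; rewrite vz e flag_vertex_mt2.
  - by rewrite e zz zz2 e mt02C mt0K mt2K.
have : z ^+ 2 \in 'C_G[(flag_vertex f, flag_edge f) | pair_action M].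
  apply/setIP; split; first exact: groupX.
  rewrite !inE /= sub1set inE /pair_act /=. 
  rewrite act_flag_vertex ?(subsetP autG) ?groupX //.
  rewrite act_flag_edge ?(subsetP autG) ?groupX //.
  by rewrite permM zf.
by rewrite regG ?flag_arc // => /set1P.
Qed.

(** The flags whose vertex is in the orbit of a base vertex under the group [H]
generated by the involutions of [G] are closed under the three flag
adjacencies: the first by [edge_swap], the other two because they preserve
the vertex. By connectedness these are all the flags, so [H] is transitive on
vertices, and it contains a vertex stabilizer, which is dihedral. *)
Lemma vertex_reversing_involution_generated (M : surface_map)
    (G : {group {perm M}}) :
  vertex_reversing G -> 3 <= #|vertices M| ->
  involution_generated G /\ 3 < #|G|.
Proof.
case=> autG regG dihGv nV.
have [f0 _] : exists f : M, True.
  have /card_gt0P[v /imsetP[f _ _]] : 0 < #|vertices M| by apply: leq_trans nV.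
  by exists f.
pose v0 := flag_vertex f0.
have Vv0 : v0 \in vertices M by apply: imset_f.
have [dihv0 _] := dihGv v0 Vv0.
split; last first.
  have [n n_gt1 dn] := dihv0.
  have := subset_leq_card (subsetIl G 'C[v0 | 'P^*]).
  rewrite (is_D2_card (A := [group of 'C_G[v0 | 'P^*]]) _ dn) ?(ltnW n_gt1) //.
  by apply: leq_trans; rewrite (leq_double 2).
pose H := [group of <<[set t in G | t ^+ 2 == 1]>>].
have sHG : H \subset G.
  by rewrite gen_subG; apply/subsetP=> t; rewrite inE => /andP[].
have invH t : t \in G -> t ^+ 2 = 1 -> t \in H.
  by move=> Gt t2; rewrite mem_gen // inE Gt t2 /=.
pose S := [set f : M | [exists h in H, 'P^*%act v0 h == flag_vertex f]].
have SP : setT \subset S.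
  rewrite -(atransP (m_connected M) f0 (in_setT f0)).
  apply: orbit_gen_sub => [|p f].
    by rewrite inE; apply/existsP; exists 1; rewrite group1 act1 /=.
  rewrite !inE -orbA => mtp /existsP[h /andP[Hh /eqP vh]].
  have stay : flag_vertex (p f) = flag_vertex f ->
      [exists h in H, 'P^*%act v0 h == flag_vertex (p f)].
    by move=> ->; apply/existsP; exists h; rewrite Hh vh eqxx.
  case/or3P: mtp => /eqP def_p; rewrite def_p in stay *.
  - have [z [Gz z2 vz]] := edge_swap f autG regG.
    apply/existsP; exists (h * z); rewrite groupM ?Hh ?(invH z) //=.
    by rewrite actM vh vz.
  - apply: stay; apply: flag_vertex_mt1.
  - apply: stay; apply: flag_vertex_mt2.
apply/subsetP=> g Gg.
have : g f0 \in S by rewrite (subsetP SP) ?inE.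
rewrite inE => /existsP[h /andP[Hh /eqP vh]].
have Gv : g * h^-1 \in 'C_G[v0 | 'P^*].
  apply/setIP; split; first by rewrite groupM ?groupV // (subsetP sHG).
  apply/astab1P; rewrite actM act_flag_vertex ?(subsetP autG) // -vh.
  by rewrite actK.
rewrite -(mulgKV h g) groupM //.
have := dihedral_involution_generated (A := [group of 'C_G[v0 | 'P^*]]) dihv0.
move/subsetP/(_ _ Gv); apply: subsetP; rewrite gen_subG.
by apply/subsetP=> t; rewrite inE => /andP[/setIP[Gt _] /eqP]; apply: invH.
Qed.

(** * The classification *)

Theorem theorem1p3 (M : surface_map) (G : {group {perm M}}) :
  vertex_reversing G ->
  3 <= #|vertices M| -> 3 <= #|faces M| ->
  solvable G ->
  (forall (p : nat) (P : {group {perm M}}),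
     prime p -> p.-Sylow(G) P -> cyclic P \/ dihedral P) ->
  [\/ dihedral G,
      (exists m e : nat,
         [/\ odd m, 2 <= e,
             (exists A B C : {group {perm M}},
                [/\ cyclic A /\ #|A| = m, B \isog 'D_(2 ^ e),
                    cyclic C /\ #|C| = 2 & (A \x B) ><| C = G])
           & (exists B C : {group {perm M}},
                [/\ B \isog 'D_(2 ^ e), is_D2 m C & B ><| C = G])]),
      (exists m n l e : nat,
         [/\ [/\ odd m, odd n & odd l],
             [/\ coprime m n, coprime m l & coprime n l], 2 <= e,
             (exists A B : {group {perm M}},
                [/\ cyclic A /\ #|A| = (m * n * l)%N, B \isog 'D_(2 ^ e)
                  & A ><| B = G])
           & (exists N : {group {perm M}},
                [/\ N <| G, cyclic N, #|N| = (2 ^ (e - 2) * m)%N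
                  & exists P Q : {group coset_of N},
                      [/\ is_D2 n P, is_D2 l Q & P \x Q = G / N]])])
    | (exists n f : nat,
         [/\ coprime n 6,
             (exists A B C : {group {perm M}},
                [/\ A \isog 'D_4, cyclic B /\ #|B| = n,
                    C \isog 'D_(2 * 3 ^ f.+1) & (A \x B) ><| C = G])
           & (exists N : {group {perm M}},
                [/\ N <| G, cyclic N, #|N| = (3 ^ f * n)%N
                  & G / N \isog [set: 'S_4]])])].

Proof.
move=> vrG nV _ solG sylG.
have [igG oG] := vertex_reversing_involution_generated vrG nV.
have cycSyl p (P : {group {perm M}}) :
    prime p -> odd p -> p.-Sylow(G) P -> cyclic P.
  move=> p_pr odd_p sylP; case: (sylG p P p_pr sylP) => // [[n n_gt1 dihP]].
  have : odd #|P|.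
    by rewrite (card_Hall sylP) p_part oddX odd_p orbT.
  by rewrite (is_D2_card (ltnW n_gt1) dihP) odd_double.
have [T sylT] := Sylow_exists 2 G.
case: (sylG 2 T isT sylT) => [cycT | [k k_gt1 dihT]].
  have ntG : G :!=: 1 by rewrite -cardG_gt1 (leq_trans _ oG).
  have dihG := cyclic_Sylow2_dihedral igG solG ntG cycSyl sylT cycT.
  constructor 1; exists #|'O_2^'(G)| => //.
  move: oG; rewrite (is_D2_card (cardG_gt0 _) dihG).
  by case: #|_| => [|[]].
have [cycO _] := odd_core_cyclic igG solG cycSyl.
have oddO : odd #|'O_2^'(G)| by rewrite odd_2'nat; apply: pcore_pgroup.
have split_case : 2^'.-Hall(G) 'O_2^'(G) -> _ := fun hallO =>
  dihedral_Sylow2_split igG cycO oddO sylT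
    (odd_core_sdprod sylT hallO) k_gt1 dihT.
have [hallO | [oW dihW cTW]] :=
  dihedral_Sylow2_dichotomy igG solG cycSyl sylT k_gt1 dihT.
  by constructor 3; apply: split_case.
have [hallO | [cGW oG24]] := klein_core_dichotomy igG solG cycSyl sylT oW cTW.
  by constructor 3; apply: split_case.
by constructor 4; apply: klein_core_structure.
Qed.
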